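(* Suppose $Z(t)$, $t\ge0$, is a stochastic process with regenerative increments over the renewal times $T_n$ such that $\mathbb{E}[T_1]$ and $\mathbb{E}[M_1]$ are finite, where $M_1:=\sup_{0\le t\le T_1}|Z(t)|$. Let $a:=\mathbb{E}[Z(T_1)]/\mathbb{E}[T_1]$. Then $$\mathbb{E}[Z(t)]=at+o(t)\qquad\text{as } t\to\infty.$$
   Context: Renewal times: $T_0:=0$ and $T_n:=\sum_{i=1}^n\xi_i$ for $n\ge 1$, where $(\xi_i)_{i\ge1}$ are i.i.d. strictly positive random variables (so $0<T_1<T_2<\cdots$ and $\xi_n=T_n-T_{n-1}$). $Z=(Z(t))_{t\ge0}$ is a real-valued stochastic process with continuous time parameter $t\in[0,\infty)$ and càdlàg (right-continuous with left limits) paths. The process $Z(t)$ has regenerative increments over the times $T_n$ if $Z(0)=0$ and the increments $$\zeta_n:=\bigl(\xi_n,\ \{Z(t+T_{n-1})-Z(T_{n-1}):0\le t\le\xi_n\}\bigr),\qquad n\ge1,$$ are i.i.d. Here the second component, defined on the random interval $[0,\xi_n]$, is regarded as a process on $[0,\infty)$ stopped at $\xi_n$, i.e. equal to $Z(\xi_n+T_{n-1})-Z(T_{n-1})$ for all $t\ge\xi_n$, so it is a random càdlàg function on $[0,\infty)$. *)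

(* Defs.v *)
From HB Require Import structures.
From mathcomp Require Import all_boot all_order all_algebra finmap.
From mathcomp Require Import all_classical all_reals all_analysis.

Set Implicit Arguments.
Unset Strict Implicit.
Unset Printing Implicit Defensive.

Import Order.TTheory GRing.Theory Num.Theory.
Import numFieldNormedType.Exports.

Local Open Scope classical_set_scope.
Local Open Scope ring_scope.

Canonical pinfty_filter_on (R : numFieldType) := FilterType (pinfty_nbhs R) _.

Section iid.
Context (R : realType) (d d' : measure_display) (Omega : measurableType d)
  (E : measurableType d') (P : probability Omega R).

Definition mutually_independent (I : choiceType) (X : I -> Omega -> E) :=
  forall (J : {fset I}) (A : I -> set E), (forall i, measurable (A i)) ->
    P (\bigcap_(i in [set` J]) (X i @^-1` A i)) =
    (\prod_(i <- J) P (X i @^-1` A i))%E.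

Definition identically_distributed (I : Type) (X : I -> Omega -> E) :=
  forall (i j : I) (A : set E), measurable A ->
    P (X i @^-1` A) = P (X j @^-1` A).

Definition iid (I : choiceType) (X : I -> Omega -> E) :=
  [/\ forall i, measurable_fun [set: Omega] (X i),
      mutually_independent X & identically_distributed X].

End iid.

(* Time is [0, +oo[; functions on it are represented by functions R -> R whose
   values at negative arguments are never looked at. *)

Definition cadlag (R : realType) (f : R -> R) :=
  (forall t, 0 <= t -> f x @[x --> t^'+] --> f t) /\
  (forall t, 0 < t -> cvg (f x @[x --> t^'-])).

Definition cylinder (R : realType) : set (set (R -> R)) :=
  [set C | exists t (B : set R),
    [/\ 0 <= t, measurable B & C = [set f | B (f t)]]].

(* Real functions on [0, +oo[ with the sigma-algebra generated by the
   evaluations. On cadlag functions its trace is the usual (Skorokhod-Borel)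
   sigma-algebra, so random cadlag functions have the same laws and the same
   independence relations here as in the space of cadlag functions. *)
Definition path_space (R : realType) := g_sigma_algebraType (@cylinder R).

Section regenerative.
Context (R : realType) (d : measure_display) (Omega : measurableType d)
  (P : probability Omega R).

(* Indices are shifted: [xi n] is the mathematical xi_(n+1). *)
Definition renewal_time (xi : nat -> Omega -> R) (n : nat) (w : Omega) : R :=
  \sum_(i < n) xi i w.

Definition renewal_steps (xi : nat -> Omega -> R) :=
  (forall n w, 0 < xi n w) /\ iid P xi.

Definition cadlag_process (Z : R -> Omega -> R) :=
  (forall t, 0 <= t -> measurable_fun [set: Omega] (Z t)) /\
  (forall w, cadlag (fun t => Z t w)).

(* The (n+1)-st increment, its path being stopped at [xi n w]. *)
Definition increment (xi : nat -> Omega -> R) (Z : R -> Omega -> R)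
    (n : nat) (w : Omega) : R * path_space R :=
  (xi n w, fun t => Z (Num.min t (xi n w) + renewal_time xi n w) w
                    - Z (renewal_time xi n w) w).

Definition regenerative_increments (xi : nat -> Omega -> R)
    (Z : R -> Omega -> R) :=
  (forall w, Z 0 w = 0) /\ iid P (increment xi Z).

Definition cycle_sup (xi : nat -> Omega -> R) (Z : R -> Omega -> R)
    (w : Omega) : \bar R :=
  ereal_sup [set `|Z t w|%:E | t in `[0, renewal_time xi 1 w]].

End regenerative.

(* Main.v *)
Require Import Defs.
From HB Require Import structures.
From mathcomp Require Import all_boot all_order all_algebra finmap.
From mathcomp Require Import all_classical all_reals all_analysis.
From mathcomp Require Import measurable_realfun ring lra.

(** The process is compared with the line of slope a cycle by cycle. Cycle n is
    said to have started by time t when T_n <= t, and m(t), the sum over n of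
    the probabilities of these events, is the mean number of started cycles.

    The event T_n <= t depends on the increments before the n-th one only, so it
    is independent of the n-th increment ([ge0_integral_independent]); summing
    over n gives Wald's identity: the mean of the sum of h(zeta_n) over the
    started cycles is E[h(zeta_0)] m(t) ([wald_identity]). Applied to
    h = min(1, xi), whose sum over the started cycles is at most t + 1, it gives
    m(t) <= (t + 1) / E[min(1, xi_0)] ([renewal_mean_le]). In particular m(t) is
    finite, and almost surely there is a cycle N in progress at time t
    ([ae_exists_cycle_in_progress]).

    Let D(t) = Z(t) - a t. The choice of a makes the increment of D over one
    cycle centred, so by Wald's identity S(t), the sum of these increments over
    the started cycles, has mean zero. But S(t) is the value of D at the end of
    cycle N, so |D(t) - S(t)| is at most twice the bound U_N of D over that
    cycle ([compensated_dist_le]), where U = M + |a| xi is integrable. For every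
    K, U_N is at most K plus the sum over all started cycles of the excess of U
    over K, and Wald's identity gives
      |E D(t)| <= 2 (K + E[max(U - K, 0)] m(t))
    ([compensated_mean_le]). Since m(t) grows at most linearly and
    E[max(U - K, 0)] tends to 0 when K grows, E D(t) = o(t). *)

Set Implicit Arguments.
Unset Strict Implicit.
Unset Printing Implicit Defensive.

Import Order.TTheory GRing.Theory Num.Theory.
Import numFieldNormedType.Exports.

Local Open Scope classical_set_scope.
Local Open Scope ring_scope.

(** * Independence of one variable from a finite group of others *)

Section independence.
Context (R : realType) (d d' : measure_display) (Omega : measurableType d)
  (E : measurableType d') (P : probability Omega R) (I : choiceType)
  (X : I -> Omega -> E).
Hypothesis mX : forall i, measurable_fun [set: Omega] (X i).

Definition joint_events (J : {fset I}) : set (set Omega) :=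
  [set C | exists2 A : I -> set E, (forall i, measurable (A i)) &
    C = \bigcap_(i in [set` J]) (X i @^-1` A i)].

Let mpreX i (A : set E) : measurable A -> measurable (X i @^-1` A).
Proof. by move=> mA; rewrite -[_ @^-1` _]setTI; exact: mX. Qed.

Lemma joint_events_measurable J : joint_events J `<=` measurable.
Proof.
move=> _ [A mA ->]; apply: fin_bigcap_measurable; first exact: finite_fset.
by move=> i _; exact: mpreX.
Qed.

Lemma sigma_joint_events_measurable J : <<s joint_events J >> `<=` measurable.
Proof.
apply: smallest_sub; first exact: sigma_algebra_measurable.
exact: joint_events_measurable.
Qed.

Lemma joint_events_setI J : setI_closed (joint_events J).
Proof.
move=> _ _ [A mA ->] [A' mA' ->].
exists (fun i => A i `&` A' i); first by move=> i; exact: measurableI.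
by rewrite -bigcapI; apply: eq_bigcapr => i _; rewrite preimage_setI.
Qed.

(** The product rule only speaks of the rectangles [joint_events J]; these are
    closed under intersection, so two finite measures that agree on them agree
    on the generated sigma-algebra. *)
Lemma independent_of_others (J : {fset I}) (j : I) (C : set Omega) (B : set E) :
  mutually_independent P X -> j \notin J ->
  <<s joint_events J >> C -> measurable B ->
  P (C `&` X j @^-1` B) = (P (X j @^-1` B) * P C)%E.
Proof.
move=> indX jJ JC mB.
have mXB := mpreX j mB.
have pB0 : 0 <= fine (P (X j @^-1` B)) by rewrite fine_ge0.
pose r := NngNum pB0.
have rE : r%:num%:E = P (X j @^-1` B) by rewrite /= fineK// fin_num_measure.
have JT : joint_events J [set: Omega].
  exists (fun=> setT) => //; rewrite predeqE => w; split=> // _ i _.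
have m12 A0 : joint_events J A0 -> mrestr P mXB A0 = mscale r P A0.
  move=> [A mA ->]; rewrite /mrestr /mscale rE.
  (* A rectangle over J and an event of j make a rectangle over j |` J. *)
  pose A' i := if i == j then B else A i.
  have mA' i : measurable (A' i) by rewrite /A'; case: ifP.
  have A'E i : i \in J -> A' i = A i.
    by move=> iJ; rewrite /A'; case: eqP jJ => // <-; rewrite iJ.
  have A'j : A' j = B by rewrite /A' eqxx.
  have -> : \bigcap_(i in [set` J]) (X i @^-1` A i) `&` X j @^-1` B =
      \bigcap_(i in [set` (j |` J)%fset]) (X i @^-1` A' i).
    rewrite predeqE => w; split=> [[JA jB] i /=|JA].
      by rewrite in_fset1U => /orP[/eqP->|iJ]; [rewrite A'j|rewrite A'E//; exact: JA].
    split=> [i /= iJ|].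
      by have := JA i; rewrite /= in_fset1U iJ orbT A'E//; exact.
    by have := JA j; rewrite /= in_fset1U eqxx A'j; exact.
  rewrite !indX// big_fsetU1//= A'j; congr (_ * _)%E.
  by rewrite indX//; apply: eq_big_seq => i iJ; rewrite A'E.
suff : mrestr P mXB C = mscale r P C by rewrite /mrestr /mscale rE.
apply: (g_sigma_algebra_measure_unique (joint_events J) _ (fun=> setT)) => //.
- exact: joint_events_measurable.
- by rewrite predeqE => w; split=> // _; exists 0%N.
- exact: joint_events_setI.
- by move=> _; rewrite /= /mrestr setTI (le_lt_trans (probability_le1 _ _))// ltry.
Qed.

Lemma measurable_joint_events (J : {fset I}) (i : I) : i \in J ->
  measurable_fun [set: g_sigma_algebraType (joint_events J)] (X i).
Proof.
move=> iJ _ B mB; rewrite setTI; apply: sub_sigma_algebra.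
exists (fun k => if k == i then B else setT); first by move=> k; case: ifP.
rewrite predeqE => w; split=> [XB k _|/(_ i iJ)]; last by rewrite eqxx.
by rewrite /preimage/=; case: eqP => // ->.
Qed.

(** Independence says that the image under [X j] of [P] restricted to [C] is the
    law of [X j] scaled by [P C]; integrate [h] against both. *)
Lemma ge0_integral_independent (J : {fset I}) (j : I) (C : set Omega)
    (h : E -> \bar R) :
  mutually_independent P X -> j \notin J -> <<s joint_events J >> C ->
  measurable_fun setT h -> (forall e, 0 <= h e)%E ->
  (\int[P]_(w in C) h (X j w) = P C * \int[P]_w h (X j w))%E.
Proof.
move=> indX jJ JC mh h0.
have mC := sigma_joint_events_measurable JC.
have pC0 : 0 <= fine (P C) by rewrite fine_ge0.
pose r := NngNum pC0.
have rE : r%:num%:E = P C by rewrite /= fineK// fin_num_measure.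
have mhX : measurable_fun setT (h \o X j) by exact: measurableT_comp.
have hX0 w : (0 <= (h \o X j) w)%E by exact: h0.
transitivity (\int[mrestr P mC]_w (h \o X j) w)%E.
  rewrite (@ge0_negligible_integral _ _ _ _ setT (~` C))//; last 2 first.
  - exact: measurableC.
  - by rewrite /= /mrestr setICl measure0.
  rewrite setTD setCK; apply: eq_measure_integral => A mA AC.
  by rewrite /= /mrestr setIidl.
have hT : {in setT, forall e, 0 <= h e}%E by move=> e _; exact: h0.
rewrite -[LHS](ge0_integral_pushforward (mX j) (mrestr P mC) measurableT mh hT).
rewrite -[X in (_ * X)%E](ge0_integral_pushforward (mX j) P measurableT mh hT).
rewrite -rE -ge0_integral_mscale//; apply: eq_measure_integral => B mB _.
rewrite /= /pushforward /mrestr /mscale -/r rE setIC.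
by rewrite (independent_of_others indX jJ)// muleC.
Qed.

End independence.

(** * Renewal times and Wald's identity *)

Lemma renewal_time0 (R : realType) (d : measure_display)
    (Omega : measurableType d) (xi : nat -> Omega -> R) w :
  renewal_time xi 0 w = 0.
Proof. by rewrite /renewal_time big_ord0. Qed.

Lemma renewal_timeS (R : realType) (d : measure_display)
    (Omega : measurableType d) (xi : nat -> Omega -> R) n w :
  renewal_time xi n.+1 w = renewal_time xi n w + xi n w.
Proof. by rewrite /renewal_time big_ord_recr. Qed.

Section wald.
Context (R : realType) (d d' : measure_display) (Omega : measurableType d)
  (E : measurableType d') (P : probability Omega R) (X : nat -> Omega -> E)
  (s : E -> R).
Hypotheses (iidX : iid P X) (ms : measurable_fun setT s).

Local Notation T := (renewal_time (fun i w => s (X i w))).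

(** The event that cycle [n] (numbered from 0) has begun by time [t]; it depends
    on the first [n] steps only, cycle [n] itself excluded. *)
Definition started (t : R) (n : nat) : set Omega := [set w | T n w <= t].

Definition cycles_sum (h : E -> \bar R) (t : R) (w : Omega) : \bar R :=
  (\sum_(0 <= n <oo) ((h \o X n) \_ (started t n)) w)%E.

(** The mean number of renewals in [0, t], the one at time 0 included. *)
Definition renewal_mean (t : R) : \bar R :=
  (\sum_(0 <= n <oo) P (started t n))%E.

Let mX n : measurable_fun setT (X n). Proof. by case: iidX. Qed.

Lemma measurable_renewal_time n : measurable_fun setT (T n).
Proof. by apply: measurable_sum => i; exact: measurableT_comp. Qed.

Let startedE t n : started t n = setT `&` T n @^-1` `]-oo, t].
Proof. by rewrite setTI; apply/seteqP; split=> w; rewrite /started /= in_itv. Qed.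

Lemma measurable_started t n : measurable (started t n).
Proof.
by rewrite startedE; apply: measurable_renewal_time.
Qed.

Lemma started_past t n :
  <<s joint_events X [fset i in iota 0 n]%fset >> (started t n).
Proof.
pose G := g_sigma_algebraType (joint_events X [fset i in iota 0 n]%fset).
have mT : measurable_fun [set: G] (T n).
  apply: measurable_sum => i; apply: (measurableT_comp ms).
  by apply: measurable_joint_events; rewrite !inE mem_iota /=.
by rewrite startedE; apply: mT => //; exact: (measurable_itv `]-oo, t]).
Qed.

Lemma ge0_integral_identical n (h : E -> \bar R) :
  measurable_fun setT h -> (forall e, 0 <= h e)%E ->
  (\int[P]_w h (X n w) = \int[P]_w h (X 0%N w))%E.
Proof.
move=> mh h0; have hT : {in setT, forall e, 0 <= h e}%E by move=> e _; exact: h0.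
rewrite -[LHS](ge0_integral_pushforward (mX n) P measurableT mh hT).
rewrite -[RHS](ge0_integral_pushforward (mX 0%N) P measurableT mh hT).
by apply: eq_measure_integral => B mB _; case: iidX => _ _; exact.
Qed.

Lemma measurable_started_term (h : E -> \bar R) t n : measurable_fun setT h ->
  measurable_fun setT ((h \o X n) \_ (started t n)).
Proof.
move=> mh; apply/(measurable_restrictT _ (measurable_started t n)).
by apply: measurable_funTS; exact: measurableT_comp.
Qed.

Lemma started_term_ge0 (h : E -> \bar R) t n w : (forall e, 0 <= h e)%E ->
  (0 <= ((h \o X n) \_ (started t n)) w)%E.
Proof. by move=> h0; apply: erestrict_ge0 => e _; exact: h0. Qed.

Lemma measurable_cycles_sum (h : E -> \bar R) t :
  measurable_fun setT h -> (forall e, 0 <= h e)%E ->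
  measurable_fun setT (cycles_sum h t).
Proof.
move=> mh h0; apply: ge0_emeasurable_sum => n.
  by move=> w _ _; exact: started_term_ge0.
by move=> _; exact: measurable_started_term.
Qed.

Lemma cycles_sum_ge0 (h : E -> \bar R) t w :
  (forall e, 0 <= h e)%E -> (0 <= cycles_sum h t w)%E.
Proof. by move=> h0; apply: nneseries_ge0 => n _ _; exact: started_term_ge0. Qed.

Lemma renewal_mean_ge0 t : (0 <= renewal_mean t)%E.
Proof. exact: nneseries_ge0. Qed.

(** The event [started t n] is decided by the variables before [X n]. *)
Lemma wald_identity (h : E -> \bar R) t :
  measurable_fun setT h -> (forall e, 0 <= h e)%E ->
  (\int[P]_w h (X 0%N w) < +oo)%E ->
  (\int[P]_w cycles_sum h t w = \int[P]_w h (X 0%N w) * renewal_mean t)%E.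
Proof.
move=> mh h0 hoo; have [_ indX _] := iidX.
rewrite integral_nneseries//; last 2 first.
- by move=> n; exact: measurable_started_term.
- by move=> n w _; exact: started_term_ge0.
have hfin : (\int[P]_w h (X 0%N w))%E \is a fin_num.
  by rewrite ge0_fin_numE// integral_ge0.
rewrite -(fineK hfin) -nneseriesZl//; apply: eq_eseriesr => n _.
rewrite -integral_mkcond fineK// -(ge0_integral_identical n mh h0) muleC.
apply: (ge0_integral_independent mX indX (j := n) _ (@started_past t n)) => //.
by rewrite !inE mem_iota /= ltnn.
Qed.

(** All started cycles but the last end by time [t], and a truncated step is at
    most 1. The bound by [T k w] is there for the induction. *)
Lemma truncated_steps_le t w k : 0 <= t -> (forall n, 0 < s (X n w)) ->
  \sum_(i < k) (if T i w <= t then Num.min 1 `|s (X i w)| else 0) <=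
  Num.min (T k w) (t + 1).
Proof.
move=> t0 s0; elim: k => [|k IH].
  by rewrite big_ord0 renewal_time0 le_min lexx/=; lra.
rewrite big_ord_recr/= renewal_timeS.
rewrite gtr0_norm//; have := s0 k; move: IH; rewrite !le_min.
move=> /andP[? ?] ?; apply/andP.
by case: (leP (T k w) t) => ?; case: (leP 1 (s (X k w))) => ?; split; lra.
Qed.

Definition truncated_step (e : E) : \bar R := (Num.min 1 `|s e|)%:E.

Lemma truncated_step_ge0 e : (0 <= truncated_step e)%E.
Proof. by rewrite lee_fin le_min ler01 normr_ge0. Qed.

Lemma measurable_truncated_step : measurable_fun setT truncated_step.
Proof.
apply/measurable_EFinP; apply: measurable_minr => //.
exact: measurableT_comp.
Qed.

Lemma truncated_step_mean : (forall n w, 0 < s (X n w)) ->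
  (0 < \int[P]_w truncated_step (X 0%N w) <= 1)%E.
Proof.
move=> s0.
have tge0 := truncated_step_ge0.
have mt : measurable_fun setT (truncated_step \o X 0%N).
  by apply: measurableT_comp => //; exact: measurable_truncated_step.
apply/andP; split; last first.
  rewrite -[leRHS](probability_setT P) -[leRHS]mul1e -integral_cst//.
  by apply: ge0_le_integral => // w _; rewrite lee_fin ge_min lexx.
rewrite lt_neqAle integral_ge0// andbT eq_sym; apply/eqP => t0.
have := ae_eq_integral_abs P measurableT mt.
rewrite (eq_integral (truncated_step \o X 0%N)); last first.
  by move=> w _; rewrite gee0_abs//; exact: truncated_step_ge0.
move=> [/(_ t0) [N [mN PN0 N1]] _].
have : P setT = 0.
  apply: (subset_measure0 _ mN _ PN0) => // w _; apply: N1 => /(_ Logic.I)/eqP.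
  by rewrite /= /truncated_step eqe gt_eqF// lt_min ltr01 normr_gt0 gt_eqF.
by rewrite probability_setT => -[] /eqP; rewrite oner_eq0.
Qed.

(** Wald's identity for the truncated steps. Untruncated steps would only bound
    [renewal_mean t] from below: the last one may overshoot [t] by any amount. *)
Lemma renewal_mean_le t : 0 <= t -> (forall n w, 0 < s (X n w)) ->
  (renewal_mean t <=
    ((t + 1) / fine (\int[P]_w truncated_step (X 0%N w)))%:E)%E.
Proof.
move=> t0 s0; have /andP[c0 c1] := truncated_step_mean s0.
have cfin : (\int[P]_w truncated_step (X 0%N w))%E \is a fin_num.
  by rewrite ge0_fin_numE ?ltW// (le_lt_trans c1) ?ltry.
rewrite EFinM lee_pdivlMr; last by rewrite fine_gt0// c0 (le_lt_trans c1) ?ltry.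
have mt := measurable_truncated_step.
rewrite fineK// muleC -wald_identity//; last 2 first.
- exact: truncated_step_ge0.
- by rewrite (le_lt_trans c1) ?ltry.
have -> : (t + 1)%:E = (\int[P]_w (t + 1)%:E)%E.
  by rewrite integral_cst// -[LHS]mule1; congr (_ * _)%E; exact/esym/(probability_setT P).
apply: ge0_le_integral => //.
- by move=> w _; apply: cycles_sum_ge0; exact: truncated_step_ge0.
- by apply: measurable_cycles_sum => //; exact: truncated_step_ge0.
move=> w _; apply: lime_le.
  apply: is_cvg_nneseries => *; apply: started_term_ge0.
  exact: truncated_step_ge0.
apply: nearW => k; rewrite big_mkord.
have := truncated_steps_le k t0 (s0^~ w).
rewrite le_min -lee_fin -[in X in _ && X]lee_fin -sumEFin => /andP[_]; apply: le_trans.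
apply: lee_sum => i _; rewrite patchE /started.
case: ifPn; first by rewrite inE /= => ->.
by rewrite notin_setE/= => /negP/negbTE ->.
Qed.

(** Borel-Cantelli: the probabilities of the events [started t n] have a finite
    sum, so almost surely only finitely many of them occur. *)
Lemma ae_exists_cycle_in_progress t : 0 <= t -> (forall n w, 0 < s (X n w)) ->
  {ae P, forall w, exists n, T n w <= t < T n.+1 w}.
Proof.
move=> t0 s0; have mS := measurable_started t.
exists (lim_sup_set (started t)); split.
- apply: bigcap_measurable => // n _; exact: bigcup_measurable.
- apply: lim_sup_set_cvg0 => //; apply: le_lt_trans (renewal_mean_le t0 s0) _.
  exact: ltry.
move=> w /= noN n _; apply: contrapT => notS; apply: noN.
have [m Tm] : exists m, t < T m w.
  exists n; rewrite ltNge; apply/negP => Tn; apply: notS; exists n => //=.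
have [[|k] tk kmin] := ex_minnP (ex_intro (fun k => t < T k w) m Tm).
  by move: tk; rewrite renewal_time0 ltNge t0.
exists k; rewrite tk andbT leNgt; apply/negP => /kmin; by rewrite ltnn.
Qed.

Lemma renewal_time_homo w : (forall n, 0 < s (X n w)) ->
  {homo T^~ w : m n / (m <= n)%N >-> m <= n}.
Proof.
move=> s0; apply: homo_leq; [exact: lexx|exact: le_trans|].
by move=> n; rewrite renewal_timeS lerDl ltW.
Qed.

Lemma cycles_sumE (h : E -> \bar R) t w N : (forall n, 0 < s (X n w)) ->
  (forall e, 0 <= h e)%E -> T N w <= t < T N.+1 w ->
  (cycles_sum h t w = \sum_(n < N.+1) h (X n w))%E.
Proof.
move=> s0 h0 /andP[TN tN]; have TT := renewal_time_homo s0.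
rewrite /cycles_sum (nneseries_split 0 N.+1); last by move=> *; exact: started_term_ge0.
rewrite add0n eseries0 ?adde0; last first.
  move=> i Ni _; rewrite patchE memNset// /started /=.
  by apply/negP; rewrite -ltNge (lt_le_trans tN)// TT.
rewrite big_mkord; apply: eq_bigr => i _; rewrite patchE mem_set//.
by rewrite /started /= (le_trans _ TN)// TT// -ltnS.
Qed.

(** For a signed [f] the series need not converge everywhere, so the positive
    and negative parts are summed apart. *)
Definition signed_cycles_sum (f : E -> \bar R) (t : R) (w : Omega) : \bar R :=
  (cycles_sum f^\+ t w - cycles_sum f^\- t w)%E.

Lemma integrable_cycles_sum (h : E -> \bar R) t :
  measurable_fun setT h -> (forall e, 0 <= h e)%E ->
  (\int[P]_w h (X 0%N w) < +oo)%E -> (renewal_mean t < +oo)%E ->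
  P.-integrable setT (cycles_sum h t).
Proof.
move=> mh h0 hoo moo; apply/integrableP; split; first exact: measurable_cycles_sum.
under eq_integral do rewrite gee0_abs ?cycles_sum_ge0//.
by rewrite wald_identity// lte_mul_pinfty ?integral_ge0// ge0_fin_numE ?integral_ge0.
Qed.

Lemma wald_identity_signed (f : E -> \bar R) t :
  measurable_fun setT f -> P.-integrable setT (f \o X 0%N) ->
  (renewal_mean t < +oo)%E ->
  P.-integrable setT (signed_cycles_sum f t) /\
  (\int[P]_w signed_cycles_sum f t w =
   \int[P]_w f (X 0%N w) * renewal_mean t)%E.
Proof.
move=> mf intf moo.
have mp : measurable_fun setT f^\+%E by exact: measurable_funepos.
have mn : measurable_fun setT f^\-%E by exact: measurable_funeneg.
have p0 e : (0 <= f^\+ e)%E by exact: funepos_ge0.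
have n0 e : (0 <= f^\- e)%E by exact: funeneg_ge0.
have pE : (\int[P]_w f^\+ (X 0%N w) = \int[P]_w (f \o X 0%N)^\+ w)%E.
  by apply: eq_integral => w _; rewrite !funeposE.
have nE : (\int[P]_w f^\- (X 0%N w) = \int[P]_w (f \o X 0%N)^\- w)%E.
  by apply: eq_integral => w _; rewrite !funenegE.
have poo : (\int[P]_w f^\+ (X 0%N w) < +oo)%E.
  rewrite pE; have := integrable_pos_fin_num measurableT intf.
  by rewrite ge0_fin_numE// integral_ge0.
have noo : (\int[P]_w f^\- (X 0%N w) < +oo)%E.
  rewrite nE; have := integrable_neg_fin_num measurableT intf.
  by rewrite ge0_fin_numE// integral_ge0.
have ip := integrable_cycles_sum mp p0 poo moo.
have in_ := integrable_cycles_sum mn n0 noo moo.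
split; first exact: integrableB.
rewrite integralB// !wald_identity//.
rewrite -muleBl; last 2 first.
- by rewrite ge0_fin_numE// renewal_mean_ge0.
- by rewrite fin_num_adde_defl// fin_numN ge0_fin_numE ?integral_ge0.
by rewrite pE nE -integralE.
Qed.

Lemma signed_cycles_sumE (f : E -> \bar R) t w N : (forall n, 0 < s (X n w)) ->
  (forall n, f (X n w) \is a fin_num) -> T N w <= t < T N.+1 w ->
  (signed_cycles_sum f t w = \sum_(n < N.+1) f (X n w))%E.
Proof.
move=> s0 ffin tN; rewrite /signed_cycles_sum !(cycles_sumE s0 _ tN)//.
elim: N.+1 => [|k IH]; first by rewrite !big_ord0 sube0.
rewrite !big_ord_recr/= -IH oppeD; last first.
  rewrite fin_num_adde_defl// funenegE; case: (f (X k w)) (ffin k) => // r _.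
  by rewrite -EFinN -EFin_max.
by rewrite addeACA; congr (_ + _)%E; rewrite [in RHS](funeposneg f).
Qed.

End wald.

(** * Measurable functionals of a stopped path *)

Section path_functionals.
Context (R : realType).
Local Notation E := (R * path_space R)%type.

Lemma measurable_path_at (u : R) : 0 <= u ->
  measurable_fun [set: E] (fun e : E => e.2 u).
Proof.
move=> u0.
have mev : measurable_fun [set: path_space R] (fun f : path_space R => f u).
  move=> _ B mB; rewrite setTI; apply: sub_sigma_algebra.
  by exists u, B.
exact: (measurableT_comp mev measurable_snd).
Qed.

(** An enumeration of the nonnegative rationals. Only countably many evaluations
    may enter a measurable functional of the path. *)
Definition nonneg_rat (k : nat) : R :=
  Num.max 0 (ratr (odflt 0 (choice.unpickle k) : rat)).

(** The supremum of |f| over [0, +oo[ for a right-continuous path [f]. *)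
Definition path_bound (e : E) : \bar R :=
  esups (fun k => `|e.2 (nonneg_rat k)|%:E) 0.

(** The final value f(s) - a s of the compensated path when [f] is stopped at
    [s]. The map (s, f) |-> f(s) need not be measurable, hence the upper limit
    along the integers: the sequence is eventually constant on stopped paths. *)
Definition path_end (a : R) (e : E) : \bar R :=
  limn_esup (fun k => (e.2 k%:R - a * e.1)%:E).

Lemma measurable_path_bound : measurable_fun [set: E] path_bound.
Proof.
apply: measurable_fun_esups => k; apply/measurable_EFinP.
apply: measurableT_comp => //; apply: measurable_path_at.
by rewrite /nonneg_rat le_max lexx.
Qed.

Lemma measurable_path_end a : measurable_fun [set: E] (path_end a).
Proof.
apply: measurable_fun_limn_esup => k; apply/measurable_EFinP.
apply: measurable_funB; first exact: measurable_path_at.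
exact: measurable_funM.
Qed.

Lemma path_bound_rat (e : E) (q : rat) : 0 <= q ->
  (`|e.2 (ratr q)|%:E <= path_bound e)%E.
Proof.
move=> q0; apply: ereal_sup_ubound; exists (choice.pickle q) => //=.
by rewrite /nonneg_rat choice.pickleK/= max_r// ler0q.
Qed.

Lemma path_bound_ge0 e : (0 <= path_bound e)%E.
Proof. by apply: le_trans (path_bound_rat e (lexx 0)); rewrite lee_fin. Qed.

Lemma le_path_bound (e : E) (M : \bar R) :
  (forall u : R, (0 <= u)%R -> `|e.2 u|%:E <= M)%E -> (path_bound e <= M)%E.
Proof.
move=> eM; apply: ge_ereal_sup => _ [k _ <-]; apply: eM.
by rewrite /nonneg_rat le_max lexx.
Qed.

Lemma right_continuous_bound (f : R -> R) (u v M : R) : u < v ->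
  f x @[x --> u^'+] --> f u ->
  (forall q : rat, u < ratr q < v -> `|f (ratr q)| <= M) -> `|f u| <= M.
Proof.
move=> uv fu fM; rewrite leNgt; apply/negP => Mf.
have eps0 : 0 < `|f u| - M by rewrite subr_gt0.
have [x ux near_u] : exists2 x, u < x & forall y, u < y < x -> `|f u - f y| < `|f u| - M.
  move/cvgrPdist_lt : fu => /(_ _ eps0) [r /= r0 fr].
  exists (u + r); first by rewrite ltrDl.
  move=> y /andP[uy yr]; apply: fr => //=.
  by rewrite ltr0_norm ?subr_lt0// opprB ltrBlDl.
have [q] : exists q : rat, ratr q \in `]u, Num.min x v[.
  by apply: rat_in_itvoo; rewrite lt_min ux.
rewrite in_itv/= lt_min => /andP[uq /andP[qx qv]].
have := fM q; rewrite uq qv => /(_ isT).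
have := near_u (ratr q); rewrite uq qx => /(_ isT).
have := ler_dist_dist (f u) (f (ratr q)).
have := ler_norm (`|f u| - `|f (ratr q)|).
lra.
Qed.

Lemma path_bound_lt (e : E) (u v : R) : 0 <= u -> u < v ->
  e.2 x @[x --> u^'+] --> e.2 u -> (`|e.2 u|%:E <= path_bound e)%E.
Proof.
move=> u0 uv eu; have := path_bound_ge0 e.
case M : (path_bound e) => [r| |] // _; last by rewrite leey.
rewrite lee_fin; apply: (right_continuous_bound uv eu) => q /andP[uq _].
by rewrite -lee_fin -M; apply: path_bound_rat; rewrite -(ler0q R) (le_trans u0)// ltW.
Qed.

Lemma path_end_stationary a (e : E) (v l : R) :
  (forall u, v <= u -> e.2 u = l) -> path_end a e = (l - a * e.1)%:E.
Proof.
move=> el; have cu : (e.2 k%:R - a * e.1)%:E @[k --> \oo] --> (l - a * e.1)%:E.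
  apply: cvg_near_cst; near=> k; rewrite el//.
  near: k; exact: nbhs_infty_ger.
by have [_] := cvg_limn_einf_sup cu.
Unshelve. all: by end_near. Qed.

End path_functionals.

(** * Cycles of a single trajectory *)

Section regenerative_paths.
Context (R : realType) (d : measure_display) (Omega : measurableType d)
  (xi : nat -> Omega -> R) (Z : R -> Omega -> R) (w : Omega).
Hypotheses (xi_gt0 : forall n, 0 < xi n w) (Zw : cadlag (Z^~ w)).

Local Notation T n := (renewal_time xi n w).
Local Notation zeta n := (increment xi Z n w).

Lemma renewal_time_ge0 n : 0 <= T n.
Proof. by apply: sumr_ge0 => i _; exact: ltW. Qed.

Lemma increment_at n t : T n <= t <= T n.+1 ->
  (zeta n).2 (t - T n) = Z t w - Z (T n) w.
Proof.
rewrite renewal_timeS => /andP[_ tT]; rewrite /= min_l ?subrK//.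
by rewrite lerBlDl.
Qed.

Lemma increment_after n u : xi n w <= u ->
  (zeta n).2 u = Z (T n.+1) w - Z (T n) w.
Proof. by move=> xu; rewrite /= min_r// renewal_timeS [xi n w + _]addrC. Qed.

Lemma increment_right_continuous n u : 0 <= u < xi n w ->
  (zeta n).2 x @[x --> u^'+] --> (zeta n).2 u.
Proof.
move=> /andP[u0 ux]; have uT0 : 0 <= u + T n by rewrite addr_ge0// renewal_time_ge0.
rewrite /= min_l ?ltW//; apply: cvgB; last exact: cvg_cst.
have [/(_ _ uT0) + _] := Zw.
move=> /cvgrPdist_lt Zu; apply/cvgrPdist_lt => eps eps0.
have [r /= r0 Zr] := Zu _ eps0.
have m0 : 0 < Num.min r (xi n w - u) by rewrite lt_min r0 subr_gt0.
exists (Num.min r (xi n w - u)) => // x /=.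
rewrite lt_min => /andP[xr xxi] ux'.
have := xxi; rewrite ltr0_norm ?subr_lt0// opprB ltrBlDr subrK => {}xxi.
rewrite min_l ?ltW//; apply: Zr; last by rewrite ltrD2r.
by rewrite /= opprD addrACA subrr addr0.
Qed.

(** Inside the cycle, right-continuity reaches the value at [t] from rational
    times; at its end, any later rational time shows the stopped value. *)
Lemma dist_cycle_le n t : T n <= t <= T n.+1 ->
  (`|Z t w - Z (T n) w|%:E <= path_bound (zeta n))%E.
Proof.
move=> tT; have /andP[Tt tTS] := tT.
rewrite -increment_at//; have u0 : 0 <= t - T n by rewrite subr_ge0.
have [ux|xu] := ltP (t - T n) (xi n w).
  by apply: (path_bound_lt u0 ux); apply: increment_right_continuous; rewrite u0.
have [q uq] : exists q : rat, t - T n < ratr q.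
  have [|q] := @rat_in_itvoo R (t - T n) (t - T n + 1); first by rewrite ltrDl.
  by rewrite in_itv/= => /andP[uq _]; exists q.
rewrite (increment_after xu) -(increment_after (ltW (le_lt_trans xu uq))).
by apply: path_bound_rat; rewrite -(ler0q R) (le_trans u0)// ltW.
Qed.

Lemma path_end_increment a n :
  path_end a (zeta n) = (Z (T n.+1) w - Z (T n) w - a * xi n w)%:E.
Proof. exact: (path_end_stationary a (@increment_after n)). Qed.

(** This makes [cycle_sup] measurable, and a function of the first increment. *)
Lemma cycle_supE : Z 0 w = 0 -> cycle_sup xi Z w = path_bound (zeta 0%N).
Proof.
move=> Z0; apply/eqP; rewrite eq_le; apply/andP; split.
  apply: ge_ereal_sup => _ [t /= + <-]; rewrite in_itv/= => tT.
  have := @dist_cycle_le 0 t; rewrite renewal_time0 Z0 subr0; exact.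
apply: le_path_bound => u u0; apply: ereal_sup_ubound.
exists (Num.min u (xi 0%N w)); last by rewrite /= renewal_time0 addr0 Z0 subr0.
rewrite /= in_itv/= renewal_timeS renewal_time0 add0r.
by rewrite le_min u0 ltW// ge_min lexx orbT.
Qed.

(** A bound for Z - a t over one cycle, relative to the start of the cycle. *)
Definition cycle_bound (a : R) (e : R * path_space R) : \bar R :=
  (path_bound e + `|a * e.1|%:E)%E.

Lemma sum_path_end a N : Z 0 w = 0 ->
  (\sum_(n < N) path_end a (zeta n) = (Z (T N) w - a * T N)%:E)%E.
Proof.
move=> Z0; elim: N => [|N IH].
  by rewrite big_ord0 renewal_time0 Z0 mulr0 subr0.
rewrite big_ord_recr /= IH path_end_increment -EFinD renewal_timeS.
by congr EFin; ring.
Qed.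

Lemma path_end_le_cycle_bound a n :
  (`|path_end a (zeta n)| <= cycle_bound a (zeta n))%E.
Proof.
rewrite path_end_increment abse_EFin.
apply: (@le_trans _ _ (`|Z (T n.+1) w - Z (T n) w|%:E + `|a * xi n w|%:E)%E).
  by rewrite -EFinD lee_fin ler_normB.
rewrite leeD2r//; apply: dist_cycle_le.
by rewrite lexx andbT renewal_timeS lerDl ltW.
Qed.

(** The sum is the compensated path at the end of cycle [N]; it and the value
    at [t] are each within [cycle_bound] of the value at the start of the
    cycle. *)
Lemma compensated_dist_le a N t : Z 0 w = 0 -> T N <= t < T N.+1 ->
  (`|(Z t w - a * t)%:E - \sum_(n < N.+1) path_end a (zeta n)| <=
   cycle_bound a (zeta N) + cycle_bound a (zeta N))%E.
Proof.
move=> Z0 /andP[Tt tT]; rewrite big_ord_recr /= sum_path_end//.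
rewrite oppeD ?fin_num_adde_defr// addeA (le_trans (lee_abs_sub _ _))//.
apply: leeD; last exact: path_end_le_cycle_bound.
rewrite -EFinB abse_EFin.
apply: (@le_trans _ _ (`|Z t w - Z (T N) w|%:E + `|a * xi N w|%:E)%E).
  rewrite -EFinD lee_fin.
  have -> : Z t w - a * t - (Z (T N) w - a * T N) =
      (Z t w - Z (T N) w) - a * (t - T N) by ring.
  have tx : t - T N <= xi N w by rewrite lerBlDl -renewal_timeS ltW.
  have x0 := ltW (xi_gt0 N).
  rewrite (le_trans (ler_normB _ _))// lerD2l !normrM ler_wpM2l//.
  by rewrite !ger0_norm// subr_ge0.
by rewrite leeD2r//; apply: dist_cycle_le; rewrite Tt ltW.
Qed.

End regenerative_paths.

(** * Approximation of integrals *)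

Section approximation.
Local Open Scope ereal_scope.
Context (R : realType) (d : measure_display) (Omega : measurableType d)
  (mu : {measure set Omega -> \bar R}).

(** Integrability of [D] comes from |D| <= |S| + B. *)
Lemma ae_close_integrable (D S B : Omega -> \bar R) :
  measurable_fun setT D -> mu.-integrable setT S ->
  mu.-integrable setT B -> (forall w, 0 <= B w) ->
  {ae mu, forall w, `|D w - S w| <= B w} ->
  mu.-integrable setT D /\
  `|\int[mu]_w D w - \int[mu]_w S w| <= \int[mu]_w B w.
Proof.
move=> mD iS iB B0 DSB.
have mS := measurable_int _ iS; have mB := measurable_int _ iB.
have iD : mu.-integrable setT D.
  apply/integrableP; split=> //.
  apply: (@le_lt_trans _ _ (\int[mu]_w (`|S w| + B w))).
    apply: ae_ge0_le_integral => //.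
    - exact: measurableT_comp.
    - by move=> w _; rewrite adde_ge0.
    - by apply: emeasurable_funD => //; exact: measurableT_comp.
    have := integrable_ae measurableT iS; apply: filterS2 DSB => w DSB /(_ Logic.I) Sfin _.
    rewrite -{1}(subeK (D w) Sfin) (le_trans (lee_abs_add _ _))//.
    by rewrite addeC leeD2l.
  rewrite ge0_integralD//; last exact: measurableT_comp.
  apply: lte_add_pinfty; first by have /integrableP[] := iS.
  have /integrableP[_] := iB; apply: le_lt_trans.
  by rewrite le_eqVlt; apply/predU1l/eq_integral => w _; rewrite gee0_abs.
split=> //; rewrite -integralB//.
apply: le_trans (le_abse_integral _ _ _) _ => //; first exact: emeasurable_funB.
apply: ae_ge0_le_integral => //; last by apply: filterS DSB => w ? _.
by apply: measurableT_comp => //; exact: emeasurable_funB.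
Qed.

(** The integrand is dominated by [f], and wherever [f] is finite it vanishes
    for large [K]. *)
Lemma integral_excess_cvg0 (f : Omega -> \bar R) :
  mu.-integrable setT f -> (forall w, 0 <= f w) ->
  \int[mu]_w maxe (f w - K%:R%:E) 0 @[K --> \oo] --> 0.
Proof.
move=> If f0; have mf := measurable_int _ If.
have [] := @dominated_convergence _ _ _ mu setT measurableT
  (fun K w => maxe (f w - K%:R%:E) 0) (cst 0) f; last 1 first.
- by move=> _ _; rewrite integral0.
- by move=> K; apply: measurable_maxe => //; exact: emeasurable_funB.
- by [].
- have := integrable_ae measurableT If; apply: filterS => w /(_ Logic.I) fw _.
  apply: cvg_near_cst; near=> K.
  apply/max_idPr; rewrite -(fineK fw) -EFinB lee_fin subr_le0.
  near: K; exact: nbhs_infty_ger.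
- exact: If.
- apply: aeW => w K _; rewrite gee0_abs ?le_max ?lexx ?orbT// ge_max f0 andbT.
  by rewrite leeBlDr// leeDl// lee_fin.
Unshelve. all: by end_near. Qed.

End approximation.

(** * Asymptotics of the mean *)

Section regenerative_mean.
Context (R : realType) (d : measure_display) (Omega : measurableType d)
  (P : probability Omega R) (xi : nat -> Omega -> R) (Z : R -> Omega -> R).
Hypotheses (hxi : renewal_steps P xi) (hZ : cadlag_process Z)
  (hreg : regenerative_increments P xi Z)
  (hT1 : ('E_P[renewal_time xi 1] < +oo)%E)
  (hM1 : (\int[P]_w cycle_sup xi Z w < +oo)%E).

Local Notation zeta := (increment xi Z).
Local Notation step := (@fst R (path_space R)).
Local Notation m := (renewal_mean P zeta step).
Let mu1 : R := fine 'E_P[renewal_time xi 1].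
Let ZT1 w := Z (renewal_time xi 1 w) w.
Let a : R := fine 'E_P[ZT1] / mu1.

Let xi_gt0 w n : 0 < xi n w. Proof. by case: hxi => + _; exact. Qed.
Let Z0 w : Z 0 w = 0. Proof. by case: hreg => + _; exact. Qed.
Let Zw w : cadlag (Z^~ w). Proof. by case: hZ => _; exact. Qed.
Let iid_zeta : iid P zeta. Proof. by case: hreg. Qed.
Let mzeta n : measurable_fun setT (zeta n). Proof. by case: iid_zeta. Qed.
Let mstep : measurable_fun [set: R * path_space R] step.
Proof. exact: measurable_fst. Qed.

Let measurable_xi n : measurable_fun setT (xi n).
Proof. exact: (measurableT_comp mstep (mzeta n)). Qed.

Let xi_integrable : P.-integrable setT (EFin \o xi 0%N).
Proof.
apply/integrableP; split; first exact/measurable_EFinP.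
apply: le_lt_trans hT1; rewrite unlock le_eqVlt; apply/predU1l/eq_integral => w _.
by rewrite /= renewal_timeS renewal_time0 add0r gtr0_norm.
Qed.

Let path_bound_integrable :
  P.-integrable setT (path_bound (R := R) \o zeta 0%N).
Proof.
apply/integrableP; split.
  by apply: measurableT_comp => //; exact: measurable_path_bound.
apply: le_lt_trans hM1; rewrite le_eqVlt; apply/predU1l/eq_integral => w _.
by rewrite gee0_abs ?path_bound_ge0// cycle_supE.
Qed.

Let measurable_cycle_bound : measurable_fun setT (cycle_bound (R := R) a).
Proof.
apply: emeasurable_funD; first exact: measurable_path_bound.
by apply/measurable_EFinP/measurableT_comp => //; exact: measurable_funM.
Qed.

Let cycle_bound_ge0 e : (0 <= cycle_bound (R := R) a e)%E.
Proof. by rewrite adde_ge0 ?path_bound_ge0// lee_fin. Qed.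

Let cycle_bound_integrable :
  P.-integrable setT (cycle_bound (R := R) a \o zeta 0%N).
Proof.
apply: integrableD => //; rewrite (_ : (fun _ => _) = (fun w => `|a%:E * (xi 0%N w)%:E|)%E)//.
by apply: integrable_abse; exact: integrableZl.
Qed.

Let drift_integrable : P.-integrable setT (path_end a \o zeta 0%N).
Proof.
apply: le_integrable cycle_bound_integrable => //.
  by apply: measurableT_comp => //; exact: measurable_path_end.
move=> w _; rewrite [leRHS]gee0_abs; last exact: cycle_bound_ge0.
exact: path_end_le_cycle_bound (xi_gt0 w) (Zw w) _ _.
Qed.

(** The slope [a] is chosen for this. *)
Let drift0 : (\int[P]_w path_end a (zeta 0%N w) = 0)%E.
Proof.
have dE w : (path_end a (zeta 0%N w) = (ZT1 w)%:E - a%:E * (xi 0%N w)%:E)%E.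
  by rewrite path_end_increment renewal_time0 Z0 subr0.
have ZT1_integrable : P.-integrable setT (EFin \o ZT1).
  apply: (eq_integrable measurableT (fun w => path_end a (zeta 0%N w) + a%:E * (xi 0%N w)%:E)%E).
    by move=> w _; rewrite dE subeK.
  by apply: integrableD => //; exact: integrableZl.
have E1 : ('E_P[renewal_time xi 1] = \int[P]_w (xi 0%N w)%:E)%E.
  by rewrite unlock; apply: eq_integral => w _; rewrite renewal_timeS renewal_time0 add0r.
have ET1 : (\int[P]_w (xi 0%N w)%:E = mu1%:E)%E.
  rewrite /mu1 E1 fineK//; exact: integrable_fin_num.
have EZ1 : (\int[P]_w (ZT1 w)%:E = (fine 'E_P[ZT1])%:E)%E.
  by rewrite fineK unlock//; exact: integrable_fin_num.
have mu1_gt0 : 0 < mu1.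
  have /andP[c0 _] := truncated_step_mean iid_zeta mstep (fun n w => xi_gt0 w n).
  rewrite -lte_fin -ET1; apply: lt_le_trans c0 _.
  apply: ge0_le_integral => //.
  - by move=> w _; rewrite lee_fin le_min ler01 normr_ge0.
  - by apply: measurableT_comp => //; exact: measurable_truncated_step.
  - exact/measurable_EFinP.
  - by move=> w _; rewrite lee_fin /= gtr0_norm// ge_min lexx orbT.
under eq_integral do rewrite dE.
rewrite integralB//; last exact: integrableZl.
rewrite integralZl// ET1 EZ1 -EFinM /a divfK ?gt_eqF// subee//.
Qed.

Let excess (K : nat) (e : R * path_space R) : \bar R :=
  maxe (cycle_bound a e - K%:R%:E)%E 0%E.

Let excess_ge0 K e : (0 <= excess K e)%E.
Proof. by rewrite le_max lexx orbT. Qed.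

Let measurable_excess K : measurable_fun setT (excess K).
Proof. by apply: measurable_maxe => //; exact: emeasurable_funB. Qed.

Let excess_lty K : (\int[P]_w excess K (zeta 0%N w) < +oo)%E.
Proof.
have /integrableP[_] := cycle_bound_integrable; apply: le_lt_trans.
apply: ge0_le_integral => //.
- by apply: measurableT_comp.
- by apply: measurableT_comp => //; exact: measurableT_comp.
move=> w _ /=; rewrite gee0_abs ?cycle_bound_ge0// ge_max cycle_bound_ge0 andbT.
by rewrite leeBlDr// leeDl// lee_fin.
Qed.

Let renewal_mean_lty (t : R) : 0 <= t -> (m t < +oo)%E.
Proof.
move=> t0; apply: le_lt_trans (ltry _).
exact: (renewal_mean_le iid_zeta mstep t0 (fun n w => xi_gt0 w n)).
Qed.

(** The variable U_N of the cycle in progress at time [t] is length-biased: its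
    mean is not that of [cycle_bound]. Bounding it by K plus the sum of the
    excesses over all the started cycles brings it back to Wald's identity. *)
Lemma compensated_mean_le (t : R) (K : nat) : 0 <= t ->
  P.-integrable setT (fun w => (Z t w - a * t)%:E) /\
  (`|\int[P]_w (Z t w - a * t)%:E| <=
   2%:E * (K%:R%:E + \int[P]_w excess K (zeta 0%N w) * m t))%E.
Proof.
move=> t0; have moo := renewal_mean_lty t0.
have [iS] := wald_identity_signed iid_zeta mstep (measurable_path_end a) drift_integrable moo.
rewrite drift0 mul0e => S0.
have iX := integrable_cycles_sum iid_zeta mstep (measurable_excess K) (excess_ge0 K)
  (excess_lty K) moo.
have iK : P.-integrable setT (cst K%:R%:E) by exact: finite_measure_integrable_cst.
set X := cycles_sum _ _ _ _ in iX.
have X0 w : (0 <= X w)%E by exact: cycles_sum_ge0.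
pose B w := (2%:E * (K%:R%:E + X w))%E.
have iB : P.-integrable setT B by apply: integrableZl => //; exact: integrableD.
have -> : (2%:E * (K%:R%:E + \int[P]_w excess K (zeta 0%N w) * m t) = \int[P]_w B w)%E.
  rewrite integralZl//; last exact: integrableD.
  rewrite integralD// wald_identity// integral_cst//; congr (_ * (_ + _))%E.
  by rewrite -[LHS]mule1; congr (_ * _)%E; exact/esym/(probability_setT P).
rewrite -[X in (`|X|)%E]sube0 -S0; apply: ae_close_integrable => //.
- apply/measurable_EFinP/measurable_funB => //; by case: hZ => + _; exact.
- by move=> w; rewrite mule_ge0// adde_ge0// lee_fin.
have := ae_exists_cycle_in_progress iid_zeta mstep t0 (fun n w => xi_gt0 w n).
apply: filterS => w [N tN].
rewrite (signed_cycles_sumE (xi_gt0 w) _ tN); last first.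
  by move=> n; rewrite path_end_increment.
apply: le_trans (compensated_dist_le (xi_gt0 w) (Zw w) a (Z0 w) tN) _.
have UB : (cycle_bound a (zeta N w) <= K%:R%:E + X w)%E.
  apply: (@le_trans _ _ (K%:R%:E + excess K (zeta N w))%E).
    by rewrite addeC -leeBlDr// le_max lexx.
  rewrite leeD2l// /X (cycles_sumE (xi_gt0 w) _ tN)// big_ord_recr/=.
  by rewrite leeDr// sume_ge0.
by rewrite /B mule_natl mule2n; exact: leeD.
Qed.

Lemma process_integrable (t : R) : 0 <= t -> P.-integrable setT (EFin \o Z t).
Proof.
move=> t0; have [iD _] := compensated_mean_le 0%N t0.
have ic : P.-integrable setT (cst (a * t)%:E) by exact: finite_measure_integrable_cst.
apply: (eq_integrable measurableT _ _ _ (integrableD measurableT iD ic)).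
by move=> w _ /=; rewrite -EFinD subrK.
Qed.

Lemma mean_deviation_le (eps : R) : 0 < eps -> exists K : R, forall t, 0 <= t ->
  `|fine 'E_P[Z t] - a * t| <= K + eps * (t + 1).
Proof.
move=> eps0.
have /andP[c0 c1] := truncated_step_mean iid_zeta mstep (fun n w => xi_gt0 w n).
pose c := fine (\int[P]_w truncated_step step (zeta 0%N w)).
have c_gt0 : 0 < c by rewrite fine_gt0// c0 (le_lt_trans c1) ?ltry.
(* As renewal_mean t <= (t + 1) / c, the excesses up to t then have a mean of
   at most eps * (t + 1) / 2. *)
have [K XK] : exists K, (\int[P]_w excess K (zeta 0%N w) <= (eps * c / 2)%:E)%E.
  have ec0 : (0 < (eps * c / 2)%:E)%E by rewrite lte_fin divr_gt0// mulr_gt0.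
  have /(_ (fun=> cycle_bound_ge0 _)) := integral_excess_cvg0 cycle_bound_integrable.
  move=> /(_ [set y | (y < (eps * c / 2)%:E)%E] (open_nbhs_nbhs _)) [].
    by split=> //; exact: open_ereal_lt_ereal.
  by move=> K _ XK; exists K; exact: ltW (XK K (leqnn K)).
exists (2 * K%:R) => t t0; have [iD le_D] := compensated_mean_le K t0.
have ic : P.-integrable setT (cst (a * t)%:E) by exact: finite_measure_integrable_cst.
have iZ := process_integrable t0.
have ED : (\int[P]_w (Z t w - a * t)%:E = (fine 'E_P[Z t] - a * t)%:E)%E.
  under eq_integral do rewrite EFinB.
  rewrite (integralB measurableT iZ ic) integral_cst// EFinB; congr (_ - _)%E.
    by rewrite unlock fineK//; exact: integrable_fin_num.
  by rewrite -[RHS]mule1; congr (_ * _)%E; exact: (probability_setT P).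
rewrite -lee_fin -abse_EFin -ED; apply: le_trans le_D _.
have -> : 2 * K%:R + eps * (t + 1) = 2 * (K%:R + eps * c / 2 * ((t + 1) / c)).
  by field; rewrite gt_eqF.
rewrite [leRHS]EFinM lee_wpmul2l// [leRHS]EFinD leeD2l// [leRHS]EFinM.
apply: lee_pmul => //; first exact: integral_ge0.
  exact: renewal_mean_ge0.
exact: (renewal_mean_le iid_zeta mstep t0 (fun n w => xi_gt0 w n)).
Qed.

End regenerative_mean.

Unset Implicit Arguments.

Theorem theorem5p3 (R : realType) (d : measure_display)
    (Omega : measurableType d) (P : probability Omega R)
    (xi : nat -> Omega -> R) (Z : R -> Omega -> R)
    (hxi : renewal_steps P xi) (hZ : cadlag_process Z)
    (hreg : regenerative_increments P xi Z)
    (hT1 : ('E_P[renewal_time xi 1] < +oo)%E)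
    (hM1 : (\int[P]_w cycle_sup xi Z w < +oo)%E) :
  let ZT1 := fun w => Z (renewal_time xi 1 w) w in
  let a := fine 'E_P[ZT1] / fine 'E_P[renewal_time xi 1] in
  (forall t, 0 <= t -> P.-integrable [set: Omega] (EFin \o Z t)) /\
  (fun t => fine 'E_P[Z t]) = (fun t => a * t) +o_ (+oo_R) id.
Proof.
move=> ZT1 a; split.
  by move=> t t0; exact: (process_integrable hxi hZ hreg hT1 hM1 t0).
apply/eqaddoP => eps eps0.
have eps20 : 0 < eps / 2 by rewrite divr_gt0.
have [K devK] := mean_deviation_le hxi hZ hreg hT1 hM1 eps20.
near=> t.
have t0 : 0 <= t by near: t; exact: nbhs_pinfty_ge.
(* From this time on, the constant is absorbed by eps / 2 * t. *)
have tK : (K + eps / 2) / (eps / 2) <= t.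
  by near: t; apply: nbhs_pinfty_ge; exact: num_real.
rewrite /= (ger0_norm t0); apply: le_trans (devK t t0) _.
by move: tK; rewrite ler_pdivrMr//; lra.
Unshelve. all: by end_near. Qed.
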